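(* Let $X_1,X_2,\dots$ be i.i.d. with distribution $G_{\boldsymbol{\beta}_0}$. Let $\widehat{\boldsymbol{\beta}}_n$ be a consistent root (i.e. $\widehat{\boldsymbol{\beta}}_n\to\boldsymbol{\beta}_0$ in probability) of the estimating equations $v_{\widehat{\boldsymbol{\beta}}_n,n}(\boldsymbol{\psi}_{\widehat{\boldsymbol{\beta}}_n})=0$. Assume that the following two conditions hold for $h_{\boldsymbol{\beta}}=\widetilde{h}_{j\boldsymbol{\beta}}$, for each $j\in\mathcal{M}_n=\{1,\dots,M_n\}$, and for $h_{\boldsymbol{\beta}}$ equal to each component of $\boldsymbol{\psi}_{\boldsymbol{\beta}}$: (1) the Taylor expansion $$v_{\widehat{\boldsymbol{\beta}}_n,n}(h_{\widehat{\boldsymbol{\beta}}_n})=v_{\boldsymbol{\beta}_0,n}(h_{\boldsymbol{\beta}_0})+(\widehat{\boldsymbol{\beta}}_n-\boldsymbol{\beta}_0)^T\nabla_{\boldsymbol{\beta}}v_{\boldsymbol{\beta},n}(h_{\boldsymbol{\beta}})\big|_{\boldsymbol{\beta}=\boldsymbol{\beta}_0}+o_P(1)$$ is valid; (2) for all $\boldsymbol{\beta}\in\mathcal{N}$, $\nabla_{\boldsymbol{\beta}}\int_{\mathcal{X}}h_{\boldsymbol{\beta}}(x)g_{\boldsymbol{\beta}}(x)\,dx=\int_{\mathcal{X}}\nabla_{\boldsymbol{\beta}}\big[h_{\boldsymbol{\beta}}(x)g_{\boldsymbol{\beta}}(x)\big]dx$. Then, for each $j\in\mathcal{M}_n$,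 as $n\to\infty$, $$v_{\boldsymbol{\beta}_0,n}(\widetilde{h}_{j\boldsymbol{\beta}_0})=v_{\boldsymbol{\beta}_0,n}(\Pi\widetilde{h}_{j\boldsymbol{\beta}_0})=v_{\widehat{\boldsymbol{\beta}}_n,n}(\widetilde{h}_{j\widehat{\boldsymbol{\beta}}_n})+o_P(1).$$
   Context: $\{G_{\boldsymbol{\beta}}:\boldsymbol{\beta}\in\mathcal{B}\subseteq\mathbb{R}^p\}$ is a parametric family of continuous distributions on $\mathcal{X}\subseteq\mathbb{R}$ with densities $g_{\boldsymbol{\beta}}$ differentiable in $\boldsymbol{\beta}$; $\boldsymbol{\beta}_0\in\mathcal{B}$ is the true parameter under the null hypothesis and $\mathcal{N}\subset\mathcal{B}$ is the closure of a neighborhood of $\boldsymbol{\beta}_0$. $L^2(G_{\boldsymbol{\beta}})$ is the real Hilbert space with inner product $\langle h,h'\rangle_{G_{\boldsymbol{\beta}}}=\int_{\mathcal{X}}hh'\,dG_{\boldsymbol{\beta}}$, and $\mathcal{L}(G_{\boldsymbol{\beta}})=\{h\in L^2(G_{\boldsymbol{\beta}}):\int_{\mathcal{X}} h\,dG_{\boldsymbol{\beta}}=0\}$. The empirical process is $v_{\boldsymbol{\beta},n}(h)=\frac{1}{\sqrt n}\sum_{i=1}^n\big[h(X_i)-\mathbb{E}_{G_{\boldsymbol{\beta}}}h(X_i)\big]$, applied componentwise to vector-valued $h$, where $\mathbb{E}_{G_{\boldsymbol{\beta}}}h(X_i)=\int_{\mathcal{X}} h\,dG_{\boldsymbol{\beta}}$;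 in $v_{\widehat{\boldsymbol{\beta}}_n,n}(h_{\widehat{\boldsymbol{\beta}}_n})$ the estimator is substituted for $\boldsymbol{\beta}$ after this expectation is computed. $\boldsymbol{u}_{\boldsymbol{\beta}}=\nabla_{\boldsymbol{\beta}}\ln g_{\boldsymbol{\beta}}$ is the score function (components in $\mathcal{L}(G_{\boldsymbol{\beta}})$), $\Gamma_{\boldsymbol{\beta}}=\langle\boldsymbol{u}_{\boldsymbol{\beta}},\boldsymbol{u}_{\boldsymbol{\beta}}^T\rangle_{G_{\boldsymbol{\beta}}}$ is the (invertible) Fisher information matrix, and $\boldsymbol{b}_{\boldsymbol{\beta}}=\Gamma_{\boldsymbol{\beta}}^{-1/2}\boldsymbol{u}_{\boldsymbol{\beta}}$ is the orthonormalized score, where $\Gamma_{\boldsymbol{\beta}}^{-1/2}$ is the principal square root of $\Gamma_{\boldsymbol{\beta}}^{-1}$. The functions $h_{j\boldsymbol{\beta}}$, $j\ge1$, are orthonormal in $L^2(G_{\boldsymbol{\beta}})$ and belong to $\mathcal{L}(G_{\boldsymbol{\beta}})$, and $$\widetilde{h}_{j\boldsymbol{\beta}}=h_{j\boldsymbol{\beta}}-\boldsymbol{b}_{\boldsymbol{\beta}}^T\langle\boldsymbol{b}_{\boldsymbol{\beta}},h_{j\boldsymbol{\beta}}\rangle_{G_{\boldsymbol{\beta}}}.$$ $\boldsymbol{\psi}_{\boldsymbol{\beta}}$ is a $p$-dimensional vector function with linearly independent components in $\mathcal{L}(G_{\boldsymbol{\beta}})$, such that the $p\times p$ matrix $\langle\boldsymbol{u}_{\boldsymbol{\beta}},\boldsymbol{\psi}_{\boldsymbol{\beta}}^T\rangle_{G_{\boldsymbol{\beta}}}$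 is invertible. The functions $\widetilde{h}_{j\boldsymbol{\beta}}$ and the components of $\boldsymbol{\psi}_{\boldsymbol{\beta}}$ are continuously differentiable in $\boldsymbol{\beta}\in\mathcal{N}$. The operator $\Pi$ is $$\Pi h_{\boldsymbol{\beta}}=h_{\boldsymbol{\beta}}-\boldsymbol{\psi}_{\boldsymbol{\beta}}^T\,\langle\boldsymbol{u}_{\boldsymbol{\beta}},\boldsymbol{\psi}_{\boldsymbol{\beta}}^T\rangle_{G_{\boldsymbol{\beta}}}^{-1}\,\langle\boldsymbol{u}_{\boldsymbol{\beta}},h_{\boldsymbol{\beta}}\rangle_{G_{\boldsymbol{\beta}}}.$$ $M_n$ is a positive integer, either fixed or growing to infinity with $n$; the asymptotic statement is for each individual index $j$ (not uniform in $j$). $o_P(1)$ denotes convergence to $0$ in probability as $n\to\infty$. *)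

(* Defs.v *)
From HB Require Import structures.
From mathcomp Require Import all_boot all_order all_algebra.
From mathcomp Require Import all_classical all_reals all_analysis.

Set Implicit Arguments.
Unset Strict Implicit.
Unset Printing Implicit Defensive.

Import Order.TTheory GRing.Theory Num.Theory.
Import numFieldNormedType.Exports.

Local Open Scope classical_set_scope.
Local Open Scope ring_scope.

(* A family of functions (h_beta) on XX is a map
   h : 'cV[R]_p -> R -> R; its values outside the parameter set B and outside
   XX are irrelevant.  Likewise a vector-valued family has type
   'cV[R]_p -> R -> 'cV[R]_p. *)

Definition gradient (R : realType) (p : nat) (f : 'cV[R]_p -> R)
    (b : 'cV[R]_p) : 'cV[R]_p :=
  \col_i 'D_(delta_mx i 0) f b.

Definition C1_on (R : realType) (p : nat) (N : set 'cV[R]_p)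
    (f : 'cV[R]_p -> R) : Prop :=
  (forall b, N b -> differentiable f b) /\ {within N, continuous (gradient f)}.

(* G is the distribution on XX with Lebesgue density g. *)
Definition has_density (R : realType) (XX : set R)
    (G : probability (measurableTypeR R) R) (g : R -> R) : Prop :=
  [/\ measurable_fun XX g, (forall x, XX x -> 0 <= g x) &
    forall A : set R, measurable A ->
      G A = (\int[@lebesgue_measure R]_(x in A `&` XX) (g x)%:E)%E].

Section L2.
Context (R : realType) (XX : set R) (G : probability (measurableTypeR R) R).

(* Membership in L^2 and L for functions on XX, extended by 0 to R. *)
Definition inL2 (h : R -> R) : Prop := (h \_ XX : measurableTypeR R -> R) \in Lfun G 2%:E.

Definition inL (h : R -> R) : Prop :=
  inL2 h /\ \int[G]_(x in XX) h x = 0.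

Definition inner (h k : R -> R) : R := \int[G]_(x in XX) (h x * k x).

Definition inner_cv (p : nat) (u : R -> 'cV[R]_p) (h : R -> R) : 'cV[R]_p :=
  \col_i inner (fun x => u x i 0) h.

(* < u , v^T > *)
Definition inner_mx (p q : nat) (u : R -> 'cV[R]_p) (v : R -> 'cV[R]_q) :
    'M[R]_(p, q) :=
  \matrix_(i, j) inner (fun x => u x i 0) (fun x => v x j 0).

Definition lin_indep (p : nat) (v : R -> 'cV[R]_p) : Prop :=
  forall c : 'cV[R]_p,
    {ae G, forall x, XX x -> ((v x)^T *m c) 0 0 = 0} -> c = 0.

End L2.

(* The positive semidefinite square root S of a symmetric matrix A; these
   three conditions determine S uniquely. *)
Definition principal_sqrt (R : realType) (p : nat) (A S : 'M[R]_p) : Prop :=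
  [/\ S^T = S, (forall v : 'cV[R]_p, 0 <= (v^T *m S *m v) 0 0) & S *m S = A].

Section Model.
Context (R : realType) (p : nat) (XX : set R).
Variables (G : 'cV[R]_p -> probability (measurableTypeR R) R)
          (g : 'cV[R]_p -> R -> R).

(* The gradient of ln g_b; it is set to 0 on the G_b-null set where the density
   vanishes and the logarithm is undefined. *)
Definition score (b : 'cV[R]_p) (x : R) : 'cV[R]_p :=
  if 0 < g b x then gradient (fun b' => ln (g b' x)) b else 0.

Definition fisher (b : 'cV[R]_p) : 'M[R]_p :=
  inner_mx XX (G b) (score b) (score b).

(* S b stands for the principal square root of (fisher b)^-1. *)
Definition orthoscore (S : 'cV[R]_p -> 'M[R]_p) (b : 'cV[R]_p) (x : R) :
    'cV[R]_p :=
  S b *m score b x.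

Definition htilde (S : 'cV[R]_p -> 'M[R]_p) (h : 'cV[R]_p -> R -> R)
    (b : 'cV[R]_p) (x : R) : R :=
  h b x
  - ((orthoscore S b x)^T *m inner_cv XX (G b) (orthoscore S b) (h b)) 0 0.

Definition PiOp (psi : 'cV[R]_p -> R -> 'cV[R]_p) (h : 'cV[R]_p -> R -> R)
    (b : 'cV[R]_p) (x : R) : R :=
  h b x
  - ((psi b x)^T *m invmx (inner_mx XX (G b) (score b) (psi b))
     *m inner_cv XX (G b) (score b) (h b)) 0 0.

(* Both sides of the identity are required to exist. *)
Definition diff_under_int (N : set 'cV[R]_p) (h : 'cV[R]_p -> R -> R) : Prop :=
  let F b := \int[@lebesgue_measure R]_(x in XX) (h b x * g b x) in
  let dF b x := gradient (fun b' => h b' x * g b' x) b in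
  forall b, N b -> forall i : 'I_p,
    [/\ derivable F b (delta_mx i 0),
        (@lebesgue_measure R).-integrable XX (fun x => (dF b x i 0)%:E) &
        gradient F b i 0 = \int[@lebesgue_measure R]_(x in XX) dF b x i 0].

End Model.

Section Asymptotics.
Context d (Omega : measurableType d) (R : realType) (P : probability Omega R).

(* Y_n = o_P(1).  Outer probability is used so that no measurability of Y_n is
   needed (plugging a random parameter into an arbitrary family of functions
   need not give a measurable map); for measurable Y_n it equals P. *)
Definition oP1 (V : normedModType R) (Y : nat -> Omega -> V) : Prop :=
  forall e : R, 0 < e ->
    mu_ext P [set w | e < `|Y n w|] @[n --> \oo] --> 0%E.

Definition mutually_independent (X : nat -> {RV P >-> R}) : Prop :=
  forall (s : seq nat) (A : nat -> set R), uniq s ->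
    (forall i, measurable (A i)) ->
    P (\bigcap_(i in [set` s]) (X i @^-1` A i))
    = (\prod_(i <- s) P (X i @^-1` A i))%E.

Definition iid (X : nat -> {RV P >-> R})
    (G : probability (measurableTypeR R) R) : Prop :=
  mutually_independent X /\
  forall i (A : set R), measurable A -> distribution P (X i) A = G A.

Variables (p : nat) (XX : set R)
  (G : 'cV[R]_p -> probability (measurableTypeR R) R)
  (X : nat -> {RV P >-> R}).

(* v_{b,n}(h) at the sample point w; the sample is X 0, ..., X (n-1). *)
Definition empproc (b : 'cV[R]_p) (n : nat) (h : R -> R) (w : Omega) : R :=
  (Num.sqrt n%:R)^-1 * \sum_(i < n) (h (X i w) - \int[G b]_(x in XX) h x).

Definition taylor_valid (b0 : 'cV[R]_p) (bhat : nat -> Omega -> 'cV[R]_p)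
    (h : 'cV[R]_p -> R -> R) : Prop :=
  oP1 (fun n w =>
    empproc (bhat n w) n (h (bhat n w)) w
    - (empproc b0 n (h b0) w
       + ((bhat n w - b0)^T
          *m gradient (fun b => empproc b n (h b) w) b0) 0 0)).

End Asymptotics.

(* Main.v *)
(** The score satisfies grad g = g * score, so that the projected functions,
    being orthogonal to the score, are fixed by Pi.  Differentiating
    0 = int f_b g_b dx under the integral sign gives
    E grad f = - <u, f> at b0, hence by the weak law of large numbers
    n^(-1/2) grad v_n(f) tends in probability to - <u, f>, which is 0 for
    f = h~_j.  For f = psi, the estimating equations and the Taylor expansion
    show that s^T A_n, where s = sqrt n (bhat_n - b0) and
    A_n = n^(-1/2) grad v_n(psi), equals - v_n(psi) + o_P(1), which is bounded in
    probability by Chebyshev's inequality; since A_n tends to the invertible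
    matrix - <u, psi^T>, so is s.  Therefore the linear term
    s^T (n^(-1/2) grad v_n(h~_j)) of the expansion of h~_j is o_P(1). *)
Require Import Defs.
From HB Require Import structures.
From mathcomp Require Import all_boot all_order all_algebra.
From mathcomp Require Import all_classical all_reals all_analysis.
From mathcomp Require Import measurable_realfun ring lra.
Import Order.TTheory GRing.Theory Num.Theory.
Import numFieldNormedType.Exports.
Local Open Scope classical_set_scope.
Local Open Scope ring_scope.

Set Implicit Arguments.
Unset Strict Implicit.
Unset Printing Implicit Defensive.

(** * Second moments of sums, which involve the variables only in pairs *)

Definition pairwise_iid d d' (Omega : measurableType d) (T : measurableType d')
    (R : realType) (P : probability Omega R) (X : nat -> Omega -> T)
    (G : probability T R) : Prop :=
  [/\ forall i, measurable_fun setT (X i),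
      forall i A, measurable A -> P (X i @^-1` A) = G A &
      forall i j A B, i != j -> measurable A -> measurable B ->
        P ((X i @^-1` A) `&` (X j @^-1` B)) = (G A * G B)%E].

Section PairwiseIID.
Context d d' (Omega : measurableType d) (T : measurableType d') (R : realType).
Variables (P : probability Omega R) (X : nat -> Omega -> T)
  (G : probability T R).
Hypothesis hX : pairwise_iid P X G.

Let mX i : measurable_fun setT (X i). Proof. by have [] := hX. Qed.

Let distX i A : measurable A -> pushforward P (X i) A = G A.
Proof. by have [_ + _] := hX; exact. Qed.

Lemma iid_ge0_integral (i : nat) (f : T -> \bar R) :
  measurable_fun setT f -> (forall x, (0 <= f x)%E) ->
  (\int[P]_w f (X i w) = \int[G]_x f x)%E.
Proof.
move=> mf f0; have := @ge0_integral_pushforward _ _ _ _ _ _ (mX i) P setT f.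
rewrite preimage_setT => <-//.
by apply: eq_measure_integral => A mA _; exact: distX.
Qed.

Lemma iid_integrable (i : nat) (f : T -> R) :
  G.-integrable setT (EFin \o f) -> P.-integrable setT (EFin \o (f \o X i)).
Proof.
move=> /integrableP[mf fi]; apply/integrableP; split.
  exact: measurableT_comp mf (mX i).
rewrite /= (@iid_ge0_integral i (fun x => `|(f x)%:E|%E))//.
exact: measurableT_comp mf.
Qed.

Lemma iid_integral (i : nat) (f : T -> R) :
  G.-integrable setT (EFin \o f) ->
  (\int[P]_w (f (X i w))%:E = \int[G]_x (f x)%:E)%E.
Proof.
move=> fi.
have := @integral_pushforward _ _ _ _ _ _ (mX i) P setT (EFin \o f).
rewrite preimage_setT => <-//.
- by apply: eq_measure_integral => A mA _; exact: distX.
- exact: measurable_int fi.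
- exact: iid_integrable.
Qed.

Lemma iid_Lfun2 (i : nat) (f : T -> R) :
  f \in Lfun G 2%:E -> f \o X i \in Lfun P 2%:E.
Proof.
rewrite inE => /andP[/[!inE]/= mf ff]; apply/andP; split.
  by rewrite inE/=; exact: measurableT_comp mf (mX i).
move: ff; rewrite inE/= /finite_norm unlock /Lnorm/=.
rewrite (@iid_ge0_integral i (fun x => (`|f x| `^ 2)%:E))//.
by apply/measurable_EFinP; apply: (measurableT_comp (measurable_powR _)) => //;
  exact: measurableT_comp.
Qed.

(** Pairwise independence gives the joint law on rectangles, and the product measure is the only one
    with these values there. *)
Lemma iid_joint (i j : nat) : i != j -> forall C, measurable C ->
  P ((fun w => (X i w, X j w)) @^-1` C) = (G \x G)%E C.
Proof.
move=> ij C mC.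
have mXX : measurable_fun setT (fun w => (X i w, X j w)).
  exact: measurable_fun_pair.
pose XX : {mfun Omega >-> (T * T)%type} :=
  HB.pack (fun w => (X i w, X j w)) (isMeasurableFun.Build _ _ _ _ _ mXX).
have := @product_measure_unique _ _ _ _ _ G G (distribution P XX).
move=> -> // A B mA mB.
by have [_ _ h] := hX; rewrite -(h i j).
Qed.

(** The expectation is transported to the product law and split by Fubini's theorem. *)
Lemma iid_integralM (i j : nat) (f : T -> R) : i != j ->
  G.-integrable setT (EFin \o f) ->
  (\int[P]_w (f (X i w) * f (X j w))%:E =
   (\int[G]_x (f x)%:E) * \int[G]_x (f x)%:E)%E.
Proof.
move=> ij fi; have mf := measurable_int _ fi.
have mf' : measurable_fun setT f by apply/measurable_EFinP.
pose F (z : T * T) : \bar R := (f z.1 * f z.2)%:E.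
have mF : measurable_fun setT F.
  apply/measurable_EFinP/measurable_funM.
    exact: measurableT_comp mf' measurable_fst.
  exact: measurableT_comp mf' measurable_snd.
have mXX : measurable_fun setT (fun w => (X i w, X j w)).
  exact: measurable_fun_pair.
have mnf : measurable_fun setT (fun x => (`|f x|)%:E).
  by apply/measurable_EFinP; exact: measurableT_comp mf'.
(* By Tonelli's theorem, the integral of [|F|] is the square of that of [|f|], hence finite. *)
have iF : (G \x G)%E.-integrable setT F.
  apply/(@integrable12ltyP _ _ _ _ _ G G F mF) => /=.
  under eq_integral.
    move=> x _; rewrite /F/=.
    under eq_integral do rewrite normrM EFinM.
    rewrite ge0_integralZl//.
    over.
  rewrite ge0_integralZr//; last exact: integral_ge0.
  move/integrableP : fi => [_ fi]; apply: lte_mul_pinfty => //.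
  + exact: integral_ge0.
  + by rewrite ge0_fin_numE//; exact: integral_ge0.
have iFX : P.-integrable setT (F \o (fun w => (X i w, X j w))).
  move/integrableP : iF => [_ iF].
  apply/integrableP; split; first exact: measurableT_comp mF mXX.
  apply: le_lt_trans iF.
  have := @ge0_integral_pushforward _ _ _ _ _ _ mXX P setT (fun z => `|F z|%E).
  rewrite preimage_setT => <-//; last exact: measurableT_comp mF.
  rewrite le_eqVlt; apply/orP; left; apply/eqP.
  by apply: eq_measure_integral => A mA _; exact: iid_joint.
transitivity (\int[(G \x G)%E]_z F z)%E.
  have := @integral_pushforward _ _ _ _ _ _ mXX P setT F mF.
  rewrite preimage_setT => <-//.
  by apply: eq_measure_integral => A mA _; exact: iid_joint.
rewrite -(@integral12_prod_meas1 _ _ _ _ _ G G F iF) /fubini_F.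
under eq_integral.
  move=> x _; rewrite /F/=.
  under eq_integral do rewrite EFinM.
  rewrite integralZl//.
  over.
have If : (\int[G]_x (f x)%:E)%E \is a fin_num by exact: integrable_fin_num.
set I := (\int[G]_x _)%E in If *.
by rewrite -(fineK If) integralZr// -/I fineK.
Qed.

Lemma iid_covariance0 (i j : nat) (f : T -> R) : i != j ->
  f \in Lfun G 2%:E -> covariance P (f \o X i) (f \o X j) = 0%E.
Proof.
move=> ij f2; have Pfin := fin_num_measure P _ measurableT.
have Gfin := fin_num_measure G _ measurableT.
have f1 := Lfun_subset12 Gfin f2.
have fi := (Lfun1_integrable _ _).1 f1.
rewrite covarianceE.
- rewrite unlock/= iid_integralM// !iid_integral//.
  by rewrite subee// fin_numM//; exact: integrable_fin_num.
- exact: Lfun_subset12 (iid_Lfun2 _ _).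
- exact: Lfun_subset12 (iid_Lfun2 _ _).
- exact: Lfun2_mul_Lfun1 (iid_Lfun2 _ _) (iid_Lfun2 _ _).
Qed.

Lemma iid_sum_Lfun2 (n : nat) (f : T -> R) : f \in Lfun G 2%:E ->
  (fun w => \sum_(i < n) f (X i w)) \in Lfun P 2%:E.
Proof.
move=> f2; elim: n => [|n ih].
  under eq_fun do rewrite big_ord0.
  exact: (Lfun_cst P 0 2).
under eq_fun do rewrite big_ord_recr/=.
apply: rpredD => //; first by rewrite lee1n.
by move=> h1; exact: (iid_Lfun2 n f2).
Qed.

Lemma iid_sum_covariance0 (n j : nat) (f : T -> R) : (n <= j)%N ->
  f \in Lfun G 2%:E ->
  covariance P (fun w => \sum_(i < n) f (X i w)) (f \o X j) = 0%E.
Proof.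
move=> + f2; elim: n => [_|n ih nj].
  under [X in covariance P X _]eq_fun do rewrite big_ord0.
  exact: covariance_cst_l.
under [X in covariance P X _]eq_fun do rewrite big_ord_recr/=.
rewrite covarianceDl ?iid_sum_Lfun2//; try exact: (iid_Lfun2 _ f2).
by rewrite ih 1?ltnW// add0e iid_covariance0// ltn_eqF.
Qed.

(** A partial sum has zero covariance with the next term, so each step of the induction adds one
    copy of the variance. *)
Lemma iid_variance_sum (n : nat) (f : T -> R) : f \in Lfun G 2%:E ->
  variance P (fun w => \sum_(i < n) f (X i w)) = (n%:R%:E * variance G f)%E.
Proof.
move=> f2; elim: n => [|n ih].
  under [X in variance P X]eq_fun do rewrite big_ord0.
  by rewrite (variance_cst P 0) mul0e.
under [X in variance P X]eq_fun do rewrite big_ord_recr/=.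
rewrite varianceD ?iid_sum_Lfun2//; last exact: (iid_Lfun2 _ f2).
rewrite (iid_sum_covariance0 (leqnn n) f2) mule0 adde0 ih.
have -> : variance P (fun w => f (X n w)) = variance G f.
  have Gfin := fin_num_measure G _ measurableT.
  have f1 := Lfun_subset12 Gfin f2.
  rewrite !varianceE//; last exact: (iid_Lfun2 _ f2).
  rewrite unlock/= iid_integral//; last exact/Lfun1_integrable.
  rewrite (@iid_integral n (fun x => f x ^+ 2))//.
  exact: Lfun2_integrable_sqr.
by rewrite -natr1 EFinD muleDl ?mul1e ?variance_fin_num.
Qed.

Lemma iid_expectation_sum (n : nat) (f : T -> R) : f \in Lfun G 2%:E ->
  expectation P (fun w => \sum_(i < n) f (X i w)) =
  (n%:R%:E * expectation G f)%E.
Proof.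
move=> f2.
have Pfin := fin_num_measure P _ measurableT.
have Gfin := fin_num_measure G _ measurableT.
have f1 := Lfun_subset12 Gfin f2.
elim: n => [|n ih].
  under [X in expectation P X]eq_fun do rewrite big_ord0.
  by rewrite (expectation_cst P 0) mul0e.
under [X in expectation P X]eq_fun do rewrite big_ord_recr/=.
rewrite expectationD; last 2 first.
- exact: Lfun_subset12 (iid_sum_Lfun2 _ f2).
- exact: Lfun_subset12 (iid_Lfun2 n f2).
have -> : expectation P (fun w => f (X n w)) = expectation G f.
  by rewrite unlock/= iid_integral//; exact/Lfun1_integrable.
rewrite ih -natr1 EFinD muleDl ?mul1e//.
exact: expectation_fin_num.
Qed.

Lemma iid_chebyshev (n : nat) (f : T -> R) (e : R) : 0 < e ->
  f \in Lfun G 2%:E ->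
  (P [set w | (e <= `|\sum_(i < n) f (X i w)
                   - n%:R * fine (expectation G f)|)%R]
   <= (e ^- 2)%:E * (n%:R%:E * variance G f))%E.
Proof.
move=> e0 f2.
have Gfin := fin_num_measure G _ measurableT.
have mS : measurable_fun setT (fun w => \sum_(i < n) f (X i w)).
  by have := iid_sum_Lfun2 n f2; rewrite inE => /andP[/[!inE]/=].
pose S : {RV P >-> R} :=
  HB.pack (fun w => \sum_(i < n) f (X i w)) (isMeasurableFun.Build _ _ _ _ _ mS).
have := chebyshev S e0; rewrite iid_variance_sum// iid_expectation_sum//.
rewrite fineM//; apply: expectation_fin_num; exact: Lfun_subset12.
Qed.

End PairwiseIID.

(** * Calculus of convergence and boundedness in outer probability *)

Section OuterProbability.
Context d (Omega : measurableType d) (R : realType) (P : probability Omega R).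

Definition vanishing (A : nat -> set Omega) : Prop :=
  mu_ext P (A n) @[n --> \oo] --> 0%E.

(** Turns convergence of extended reals into upper bounds, which combine directly with
    subadditivity; these suffice because outer probability is nonnegative. *)
Lemma vanishingP (A : nat -> set Omega) :
  vanishing A <->
  forall e : R, 0 < e -> \forall n \near \oo, (mu_ext P (A n) <= e%:E)%E.
Proof.
split=> [A0 e e0|A0].
  have e0N : nbhs 0%E [set x | (x < e%:E)%E].
    by apply: (@open_ereal_lt' _ 0%E e%:E); rewrite lte_fin.
  have : \forall n \near \oo, (mu_ext P (A n) < e%:E)%E by exact: (A0 _ e0N).
  by apply: filterS => n /ltW.
apply/fine_cvgP; split.
  have := A0 _ ltr01; apply: filterS => n An; rewrite ge0_fin_numE ?mu_ext_ge0//.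
  exact: le_lt_trans An (ltry _).
apply/cvgr0Pnorm_le => e e0; have := A0 _ e0; apply: filterS => n An /=.
rewrite ger0_norm ?fine_ge0 ?mu_ext_ge0// -lee_fin fineK//.
by rewrite ge0_fin_numE ?mu_ext_ge0//; exact: le_lt_trans An (ltry _).
Qed.

Lemma sub_vanishing (A B : nat -> set Omega) :
  (\forall n \near \oo, A n `<=` B n) -> vanishing B -> vanishing A.
Proof.
move=> AB /vanishingP B0; apply/vanishingP => e /B0.
move: AB; apply: filterS2 => n AB; apply: le_trans.
exact: le_mu_ext.
Qed.

Lemma vanishingU (A B : nat -> set Omega) :
  vanishing A -> vanishing B -> vanishing (fun n => A n `|` B n).
Proof.
move=> /vanishingP A0 /vanishingP B0; apply/vanishingP => e e0.
have e20 : 0 < e / 2 by rewrite divr_gt0.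
have := B0 _ e20; have := A0 _ e20; apply: filterS2 => n An Bn.
rewrite (le_trans (outer_measureU2 (mu_ext P) _ _))//.
by rewrite [e]splitr EFinD leeD.
Qed.

Lemma negligible_mu_ext (A : set Omega) : P.-negligible A -> mu_ext P A = 0%E.
Proof.
move=> [B [mB B0 AB]]; apply/eqP; rewrite eq_le mu_ext_ge0// andbT -B0.
by rewrite -measurable_mu_extE//; exact: le_mu_ext.
Qed.

(** This is $O_P(1)$, with the bound required for large [n] only; outer probability is used for the
    same reason as in [oP1]. *)
Definition tight (Y : nat -> Omega -> R) : Prop :=
  forall e : R, 0 < e -> exists2 K : R, 0 < K &
    \forall n \near \oo, (mu_ext P [set w | (K < `|Y n w|)%R] <= e%:E)%E.

Section oP1.
Variable V : normedModType R.
Implicit Types Y Z : nat -> Omega -> V.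

(** The null set where domination fails has outer probability zero. As almost surely equal sequences
    dominate each other, this also serves to rewrite under [oP1]. *)
Lemma le_oP1 (W : normedModType R) Y (Z : nat -> Omega -> W) :
  (\forall n \near \oo, {ae P, forall w, `|Y n w| <= `|Z n w|}) ->
  oP1 P Z -> oP1 P Y.
Proof.
move=> YZ Z0 e e0.
apply: (@sub_vanishing _ (fun n => [set w | e < `|Z n w|] `|`
    [set w | ~ `|Y n w| <= `|Z n w|])).
  apply: nearW => n w /= eY; have [YZw|] := boolP (`|Y n w| <= `|Z n w|).
    by left; exact: lt_le_trans eY _.
  by right; exact/negP.
apply: vanishingU; first exact: Z0.
apply: cvg_near_cst; move: YZ; apply: filterS => n YZn; exact: negligible_mu_ext.
Qed.

Lemma oP1D Y Z : oP1 P Y -> oP1 P Z -> oP1 P (fun n w => Y n w + Z n w).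
Proof.
move=> Y0 Z0 e e0; have e20 : 0 < e / 2 by rewrite divr_gt0.
apply: (@sub_vanishing _ (fun n => [set w | e / 2 < `|Y n w|] `|`
    [set w | e / 2 < `|Z n w|])); last first.
  by apply: vanishingU; [exact: Y0|exact: Z0].
apply: nearW => n w /= eYZ; apply/orP; apply: contraLR eYZ.
rewrite negb_or -!leNgt => /andP[Yw Zw].
by rewrite (le_trans (ler_normD _ _))// [e]splitr lerD.
Qed.

Lemma oP1_0 : oP1 P (fun _ _ => 0 : V).
Proof.
move=> e e0; apply: cvg_near_cst; apply: nearW => n.
rewrite (_ : [set _ | _] = set0) ?measure0 ?mu_ext0//.
by apply/seteqP; split => // w /=; rewrite normr0 ltNge ltW.
Qed.

Lemma oP1_sum (I : Type) (r : seq I) (Y : I -> nat -> Omega -> V) :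
  (forall i, oP1 P (Y i)) -> oP1 P (fun n w => \sum_(i <- r) Y i n w).
Proof.
move=> Y0; elim: r => [|i r ih].
  by apply: le_oP1 oP1_0; apply: nearW => n; apply: aeW => w; rewrite big_nil.
apply: le_oP1 (oP1D (Y0 i) ih).
by apply: nearW => n; apply: aeW => w; rewrite big_cons.
Qed.

End oP1.

Lemma oP1_tight (Y : nat -> Omega -> R) : oP1 P Y -> tight Y.
Proof.
move=> Y0 e e0; exists 1 => //.
by have /vanishingP := Y0 _ ltr01; exact.
Qed.

Lemma le_tight (Y Z : nat -> Omega -> R) :
  (\forall n \near \oo, {ae P, forall w, `|Y n w| <= `|Z n w|}) ->
  tight Z -> tight Y.
Proof.
move=> YZ Z0 e /Z0[K K0 ZK]; exists K => //.
move: YZ ZK; apply: filterS2 => n YZn; apply: le_trans.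
rewrite -[leRHS]adde0 -(negligible_mu_ext YZn).
apply: le_trans (outer_measureU2 (mu_ext P) _ _).
apply: le_mu_ext => w /= eY; have [YZw|] := boolP (`|Y n w| <= `|Z n w|).
  by left; exact: lt_le_trans eY _.
by right; exact/negP.
Qed.

Lemma tightD (Y Z : nat -> Omega -> R) :
  tight Y -> tight Z -> tight (fun n w => Y n w + Z n w).
Proof.
move=> Y0 Z0 e e0; have e20 : 0 < e / 2 by rewrite divr_gt0.
have [K K0 YK] := Y0 _ e20; have [L L0 ZL] := Z0 _ e20.
exists (K + L); first exact: addr_gt0.
move: YK ZL; apply: filterS2 => n Yn Zn; rewrite [e]splitr EFinD.
apply: le_trans (leeD Yn Zn).
apply: le_trans (outer_measureU2 (mu_ext P) _ _).
apply: le_mu_ext => w /= eYZ; apply/orP; apply: contraLR eYZ.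
rewrite negb_or -!leNgt => /andP[Yw Zw].
by rewrite (le_trans (ler_normD _ _))// lerD.
Qed.

Lemma tight_sum (I : Type) (r : seq I) (Y : I -> nat -> Omega -> R) :
  (forall i, tight (Y i)) -> tight (fun n w => \sum_(i <- r) Y i n w).
Proof.
move=> Y0; elim: r => [|i r ih].
  apply: le_tight (oP1_tight (oP1_0 R)).
  by apply: nearW => n; apply: aeW => w; rewrite big_nil.
apply: le_tight (tightD (Y0 i) ih).
by apply: nearW => n; apply: aeW => w; rewrite big_cons.
Qed.

(** The product exceeds [e] only where [|Y|] exceeds [K] or [|Z|] exceeds [e / K]; tightness fixes
    [K] before [Z] is estimated. *)
Lemma tightM_oP1 (Y Z : nat -> Omega -> R) :
  tight Y -> oP1 P Z -> oP1 P (fun n w => Y n w * Z n w).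
Proof.
move=> Yt Z0 e e0; apply/vanishingP => h h0.
have h20 : 0 < h / 2 by rewrite divr_gt0.
have [K K0 YK] := Yt _ h20.
have eK0 : 0 < e / K by rewrite divr_gt0.
have /vanishingP/(_ _ h20) ZK := Z0 _ eK0.
move: YK ZK; apply: filterS2 => n Yn Zn; rewrite [h]splitr EFinD.
apply: le_trans (leeD Yn Zn).
apply: le_trans (outer_measureU2 (mu_ext P) _ _).
apply: le_mu_ext => w /= eYZ; apply/orP; apply: contraLR eYZ.
rewrite negb_or -!leNgt normrM => /andP[Yw Zw].
by rewrite -[e](divfK (lt0r_neq0 K0)) mulrC ler_pM.
Qed.

End OuterProbability.

Import HBSimple.

(** * Tightness of normalized sums and the weak law of large numbers *)

Section WeakLaw.
Context d d' (Omega : measurableType d) (T : measurableType d') (R : realType).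
Variables (P : probability Omega R) (X : nat -> Omega -> T)
  (G : probability T R).
Hypothesis hX : pairwise_iid P X G.

(** The sum has variance [n * V], so Chebyshev's inequality at the threshold $K\sqrt n$ gives the
    bound $V/K^2$, which is free of [n]. *)
Lemma iid_tight_sum (f : T -> R) :
  f \in Lfun G 2%:E -> (\int[G]_x (f x)%:E = 0)%E ->
  tight P (fun n w => (Num.sqrt n%:R)^-1 * \sum_(i < n) f (X i w)).
Proof.
move=> f2 f0 e e0; pose V := fine (variance G f).
have V0 : 0 <= V by rewrite fine_ge0// variance_ge0.
(* With this choice [1 <= K] and [V <= e * K], whence [V / K ^+ 2 <= e]. *)
pose K := V / e + 1.
have K1 : 1 <= K by rewrite lerDr divr_ge0// ltW.
have K0 : 0 < K by exact: lt_le_trans K1.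
exists K => //; near=> n.
have n0 : (0 : R) < n%:R by rewrite ltr0n; near: n; exact: nbhs_infty_gt.
have sn0 : 0 < Num.sqrt (n%:R : R) by rewrite sqrtr_gt0.
have mS : measurable_fun setT (fun w => \sum_(i < n) f (X i w)).
  by have := iid_sum_Lfun2 hX n f2; rewrite inE => /andP[/[!inE]/=].
have Ksn : 0 < K * Num.sqrt n%:R by rewrite mulr_gt0.
(* This event is measurable, so its outer probability is its probability, and it contains the event
   with strict inequality. *)
pose A := [set w | K * Num.sqrt n%:R <= `|\sum_(i < n) f (X i w)|].
have mA : measurable A.
  rewrite -[A]setTI; apply: (measurable_fun_le measurableT) => //.
  exact: measurableT_comp.
apply: (@le_trans _ _ (P A)).
  rewrite -(measurable_mu_extE P mA); apply: le_mu_ext => w /=.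
  rewrite normrM ger0_norm ?invr_ge0 ?sqrtr_ge0// mulrC.
  by rewrite ltr_pdivlMr// => /ltW.
have := iid_chebyshev hX n Ksn f2.
have -> : expectation G f = 0%E by rewrite unlock.
rewrite mulr0; under eq_set do rewrite subr0.
move=> /le_trans; apply.
rewrite -(fineK (variance_fin_num f2)) -/V -!EFinM lee_fin.
rewrite exprMn sqr_sqrtr ?ler0n//.
have -> : (K ^+ 2 * n%:R)^-1 * (n%:R * V) = V / K ^+ 2.
  by field; rewrite !gt_eqF.
rewrite ler_pdivrMr ?exprn_gt0//.
have : V <= e * K by rewrite mulrDr mulr1 mulrC divfK ?gt_eqF// lerDl ltW.
move=> /le_trans; apply; rewrite ler_pM2l// expr2 ler_pMr//.
Unshelve. all: by end_near. Qed.

Lemma cvg0_oP1 (u : nat -> R) : u n @[n --> \oo] --> (0 : R) ->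
  oP1 P (fun n _ => u n).
Proof.
move=> u0 e e0; apply: cvg_near_cst.
have /cvgr0Pnorm_le/(_ e e0) := u0; apply: filterS => n une.
rewrite (_ : [set _ | _] = set0) ?mu_ext0//.
by apply/seteqP; split => // w /=; rewrite ltNge une.
Qed.

Let cvg_inv_sqrt : (Num.sqrt (n%:R : R))^-1 @[n --> \oo] --> (0 : R).
Proof.
apply/cvgr0Pnorm_le => e e0; near=> n.
have n0 : (0 : R) < n%:R by rewrite ltr0n; near: n; exact: nbhs_infty_gt.
have sn0 : 0 < Num.sqrt (n%:R : R) by rewrite sqrtr_gt0.
rewrite ger0_norm ?invr_ge0 ?sqrtr_ge0// invf_ple// ?posrE//.
have ei0 : 0 <= e^-1 by rewrite invr_ge0 ltW.
rewrite -(ger0_norm ei0) -sqrtr_sqr ler_sqrt ?ler0n//.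
by near: n; exact: nbhs_infty_ger.
Unshelve. all: by end_near. Qed.

(** The centred sample mean is a tight normalized sum times $n^{-1/2}$. *)
Let weak_law_Lfun2 (f : T -> R) : f \in Lfun G 2%:E ->
  oP1 P (fun n w => n%:R^-1 * \sum_(i < n) f (X i w)
                    - fine (\int[G]_x (f x)%:E)%E).
Proof.
move=> f2; set m := fine _.
have Gfin := fin_num_measure G _ measurableT.
have fi := (Lfun1_integrable _ _).1 (Lfun_subset12 Gfin f2).
pose f' x := f x - m.
have f'2 : f' \in Lfun G 2%:E.
  apply: rpredB => //; first by rewrite lee1n.
  by move=> h1; exact: Lfun_cst.
have f'0 : (\int[G]_x (f' x)%:E = 0)%E.
  under eq_integral do rewrite EFinB.
  rewrite integralB//=; last exact: finite_measure_integrable_cst.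
  rewrite integral_cst//. rewrite [X in (_ - _ * X)%E]probability_setT mule1 /m fineK ?subee//.
    exact: integrable_fin_num.
  exact: integrable_fin_num.
apply: le_oP1 (tightM_oP1 (iid_tight_sum f'2 f'0) (cvg0_oP1 cvg_inv_sqrt)).
near=> n; apply: aeW => w.
have n0 : (0 : R) < n%:R by rewrite ltr0n; near: n; exact: nbhs_infty_gt.
have sn0 : Num.sqrt (n%:R : R) != 0 by rewrite gt_eqF// sqrtr_gt0.
rewrite mulrAC -invfM -expr2 sqr_sqrtr ?ler0n// /f' sumrB sumr_const card_ord.
by rewrite mulrBr -[m *+ n]mulr_natl mulKf ?gt_eqF.
Unshelve. all: by end_near. Qed.

(** Markov's inequality at the threshold [e * n] for the sum of the [|f (X i)|], whose expectation
    is at most [n * c]. *)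
Let iid_markov (f : T -> R) (n : nat) (e c : R) : 0 < e -> (0 < n)%N ->
  G.-integrable setT (EFin \o f) -> (\int[G]_x `|(f x)%:E| <= c%:E)%E ->
  (mu_ext P [set w | (e < `|n%:R^-1 * \sum_(i < n) f (X i w)|)%R]
   <= (c / e)%:E)%E.
Proof.
move=> e0 n0 fi fc; have [mX _ _] := hX.
have mf : measurable_fun setT f by apply/measurable_EFinP; exact: measurable_int fi.
have en0 : 0 < e * n%:R by rewrite mulr_gt0// ltr0n.
pose S w := \sum_(i < n) `|f (X i w)|.
have mS : measurable_fun setT (fun w => (S w)%:E).
  apply/measurable_EFinP; apply: measurable_sum => i.
  by apply: measurableT_comp => //; exact: measurableT_comp mf (mX i).
pose A := [set w | ((e * n%:R)%:E <= `|(S w)%:E|)%E].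
have mA : measurable A.
  rewrite -[A]setTI; apply: emeasurable_fun_c_infty => //.
  exact: measurableT_comp.
apply: (@le_trans _ _ (P A)).
  rewrite -(measurable_mu_extE P mA); apply: le_mu_ext => w /=.
  rewrite normrM ger0_norm ?invr_ge0// mulrC ltr_pdivlMr ?ltr0n// => /ltW eS.
  rewrite /A/= lee_fin (le_trans eS)// (le_trans (ler_norm_sum _ _ _))//.
  exact: ler_norm.
have := le_integral_abse P measurableT mS en0; rewrite setTI -/A.
rewrite -lee_pdivlMl// => /le_trans; apply.
under eq_integral do rewrite gee0_abs ?lee_fin ?sumr_ge0// -sumEFin.
rewrite ge0_integral_sum//; last first.
  move=> i; apply/measurable_EFinP; apply: measurableT_comp => //.
  exact: measurableT_comp mf (mX i).
under eq_bigr => i _.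
  rewrite (iid_ge0_integral hX i (f := fun x => (`|f x|)%:E))//; last first.
    by apply/measurable_EFinP; exact: measurableT_comp.
  over.
apply: (@le_trans _ _ ((e * n%:R)^-1%:E * \sum_(i < n) c%:E)%E).
  by rewrite lee_pmul2l ?lte_fin ?invr_gt0//; apply: lee_sum => i _.
rewrite sumEFin -EFinM lee_fin sumr_const card_ord -mulr_natl.
rewrite le_eqVlt; apply/orP; left; apply/eqP; field.
by rewrite gt_eqF//= gt_eqF// ltr0n.
Qed.

Let sfun_Lfun2 (g : {sfun T >-> R}) : (g : T -> R) \in Lfun G 2%:E.
Proof.
have [M [_ gM]] := simple_bounded g.
(* The bound is available only for numbers strictly above [M]. *)
have {}gM x : `|g x| <= M + 1 by apply: gM => //; rewrite ltrDl.
apply/andP; split; first by rewrite inE/=; exact: measurable_funPT.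
rewrite inE/= /finite_norm unlock /Lnorm poweR_lty//=.
apply: (@le_lt_trans _ _ (\int[G]_x (cst (((M + 1) `^ 2)%:E) x))%E).
  apply: ge0_le_integral => //=.
  - apply/measurable_EFinP; apply: (measurableT_comp (measurable_powR _)) => //.
    exact: measurableT_comp.
  - move=> x _; rewrite lee_fin ge0_ler_powR// nnegrE.
    exact: le_trans (gM x).
rewrite integral_cst// [X in (_ * X)%E]probability_setT mule1.
exact: ltry.
Qed.

(* Since f need not be square integrable, it is replaced by a simple function
   close to it in L^1, to which Chebyshev's inequality applies. *)
Lemma weak_law (f : T -> R) : G.-integrable setT (EFin \o f) ->
  oP1 P (fun n w => n%:R^-1 * \sum_(i < n) f (X i w)
                    - fine (\int[G]_x (f x)%:E)%E).
Proof.
move=> fi e e0; apply/vanishingP => h h0; set m := fine _.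
have e30 : 0 < e / 3 by rewrite divr_gt0.
have h20 : 0 < h / 2 by rewrite divr_gt0.
(* The factor [1] in the minimum keeps the change of mean below [e / 3]; the factor [h / 2] keeps
   the Markov bound [c / (e / 3)] for [f - g] below [h / 2]. *)
pose c := e / 3 * Num.min 1 (h / 2).
have c0 : 0 < c by rewrite mulr_gt0// lt_min ltr01.
have ce : c <= e / 3 by rewrite -[leRHS]mulr1 ler_pM2l// ge_min lexx.
have che : c / (e / 3) <= h / 2.
  rewrite /c mulrAC divff ?gt_eqF// mul1r.
  by rewrite ge_min lexx orbT.
have [g_ [gi _ gf]] := approximation_sfun_integrable measurableT fi.
have [g gc] : exists g : {sfun T >-> R},
    G.-integrable setT (EFin \o g) /\
    (\int[G]_x `|(f x - g x)%:E| <= c%:E)%E.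
  have c0N : nbhs 0%E [set x | (x < c%:E)%E].
    by apply: (@open_ereal_lt' _ 0%E c%:E); rewrite lte_fin.
  have : \forall n \near \oo, (\int[G]_z `|(f z)%:E - (g_ n z)%:E| < c%:E)%E.
    exact: (gf _ c0N).
  by move=> /filter_ex[n gn]; exists (g_ n); split; [exact: gi|exact: ltW].
have {}gi := gc.1; have {}gc := gc.2.
have g2 := sfun_Lfun2 g.
have fgi : G.-integrable setT (EFin \o (fun x => f x - g x)).
  exact: (integrableB measurableT fi gi).
have mfg : `|fine (\int[G]_x (g x)%:E)%E - m| <= e / 3.
  have := le_normr_Rintegral measurableT fgi.
  rewrite [X in `|X|]RintegralB// distrC => /le_trans; apply.
  apply: le_trans ce; rewrite -lee_fin fineK//.
  rewrite ge0_fin_numE; last exact: integral_ge0.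
  exact: le_lt_trans gc (ltry _).
have /vanishingP/(_ _ h20) gn := weak_law_Lfun2 g2 e30.
near=> n.
have n0 : (0 < n)%N by near: n; exact: nbhs_infty_gt.
have gn' : (mu_ext P [set w | (e / 3 < `|n%:R^-1 * \sum_(i < n) g (X i w)
    - fine (\int[G]_x (g x)%:E)%E|)%R] <= (h / 2)%:E)%E by near: n.
have fn := iid_markov e30 n0 fgi gc.
have {}fn := le_trans fn (che : (_%:E <= (h / 2)%:E)%E).
rewrite [h]splitr EFinD (le_trans _ (leeD fn gn'))//.
rewrite (le_trans _ (outer_measureU2 (mu_ext P) _ _))//.
apply: le_mu_ext => w /= eYZ; apply/orP; apply: contraLR eYZ.
rewrite negb_or -!leNgt => /andP[Yw Zw].
pose mg := fine (\int[G]_x (g x)%:E)%E.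
(* The three errors are the sample mean of [f - g], the deviation of the sample mean of [g] from its
   expectation, and the difference of the two expectations. *)
have -> : n%:R^-1 * \sum_(i < n) f (X i w) - m =
    n%:R^-1 * (\sum_(i < n) (f (X i w) - g (X i w)))
    + (n%:R^-1 * \sum_(i < n) g (X i w) - mg) + (mg - m).
  by rewrite sumrB; ring.
rewrite (le_trans (ler_normD _ _))//.
have -> : e = e / 3 + e / 3 + e / 3 by field.
rewrite lerD// (le_trans (ler_normD _ _))// lerD//.
Unshelve. all: by end_near. Qed.

End WeakLaw.

(** * Integration against a distribution given by a density *)

Section Density.
Context (R : realType) (XX : set R).
Variables (G : probability (measurableTypeR R) R) (g : R -> R).
Hypotheses (mXX : measurable XX) (hG : has_density XX G g).
Local Notation mu := (@lebesgue_measure R).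
Local Notation RN := (Radon_Nikodym_SigmaFinite.f G mu).

Let mg : measurable_fun (XX : set (measurableTypeR R)) (EFin \o g).
Proof. by have [mg _ _] := hG; exact/measurable_EFinP. Qed.

Let dominated : G `<< mu.
Proof.
have [_ _ GE] := hG.
apply/null_content_dominatesP => A mA A0.
have mAX : measurable (A `&` XX) by exact: measurableI.
rewrite GE// null_set_integral//.
- by apply: measurable_funS mg => //; exact: subIsetr.
- exact: (subset_measure0 mAX mA (@subIsetl _ _ _) A0).
Qed.

(** Both functions integrate to [G E] over every measurable [E] inside [XX], which determines them
    almost everywhere there. *)
Let RN_density : ae_eq mu XX RN (EFin \o g).
Proof.
have [_ _ GE] := hG.
apply: integral_ae_eq => //.
  apply: (integrableS measurableT) => //.
  exact: Radon_Nikodym_SigmaFinite.f_integrable.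
move=> E EXX mE; rewrite -[E in RHS](setIidl EXX) -GE//.
by rewrite (Radon_Nikodym_SigmaFinite.f_integral dominated).
Qed.

Lemma density_ge0_integral (f : R -> \bar R) : (forall x, (0 <= f x)%E) ->
  measurable_fun XX f ->
  (\int[mu]_(x in XX) (f x * (g x)%:E) = \int[G]_(x in XX) f x)%E.
Proof.
move=> f0 mf.
rewrite -(Radon_Nikodym_SigmaFinite.change_of_variables dominated f0 mXX mf).
have mRN : measurable_fun (XX : set (measurableTypeR R)) RN.
  apply: measurable_funTS.
  exact: measurable_int (Radon_Nikodym_SigmaFinite.f_integrable dominated).
apply: ae_eq_integral => //.
- exact: emeasurable_funM.
- exact: emeasurable_funM.
- by apply: filterS RN_density => x RNx Xx; rewrite RNx.
Qed.

Lemma density_integrable (f : R -> R) : measurable_fun XX f ->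
  G.-integrable XX (EFin \o f) <->
  mu.-integrable XX (fun x => (f x * g x)%:E).
Proof.
move=> mf; have [mg' g0 _] := hG.
have E : (\int[mu]_(x in XX) `|(f x * g x)%:E| =
          \int[G]_(x in XX) `|(f x)%:E|)%E.
  rewrite -density_ge0_integral//; last first.
    by apply/measurable_EFinP; exact: measurableT_comp.
  apply: eq_integral => x /set_mem Xx.
  by rewrite /= normrM (ger0_norm (g0 _ Xx)) EFinM.
split=> /integrableP[_ fi]; apply/integrableP; split.
- by apply/measurable_EFinP; exact: measurable_funM.
- by rewrite E.
- exact/measurable_EFinP.
- by rewrite -E.
Qed.

Lemma density_integral (f : R -> R) : G.-integrable XX (EFin \o f) ->
  \int[mu]_(x in XX) (f x * g x) = \int[G]_(x in XX) f x.
Proof.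
move=> fi; congr fine; have mf := measurable_int _ fi.
rewrite -(Radon_Nikodym_change_of_variables dominated mXX fi).
apply: ae_eq_integral => //.
- by under eq_fun do rewrite EFinM; exact: emeasurable_funM.
- apply: emeasurable_funM => //; apply: measurable_funTS.
  have := @Radon_Nikodym_integrable _ _ _ (charge_of_finite_measure G) mu dominated.
  exact: measurable_int.
(* For signed [f] the change of variables uses the derivative of [G] as a charge; it agrees almost
   everywhere with [RN], hence with [g]. *)
- have := ae_eq_Radon_Nikodym_SigmaFinite dominated mXX.
  apply: filterS2 RN_density => x RNx RNx' Xx.
  by rewrite -RNx'// RNx// EFinM.
Qed.

Lemma density_setC0 : G (~` XX) = 0%E.
Proof.
by have [_ _ ->//] := hG; rewrite ?setICl ?integral_set0//; exact: measurableC.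
Qed.

(** This makes the default value in [score] harmless, since it is taken on a null set of [XX]. *)
Lemma density_eq0_null : G (XX `&` [set x | g x = 0]) = 0%E.
Proof.
have [mg' _ GE] := hG; rewrite GE.
  by apply: integral0_eq => x /= [[_ ->]].
by rewrite -[[set x | _]]/(g @^-1` [set 0]); exact: mg'.
Qed.

End Density.

(** * Gradients with respect to the parameter *)

Section Gradient.
Context (R : realType) (p : nat).
Implicit Types (f k : 'cV[R]_p -> R) (b v : 'cV[R]_p).

Lemma gradientM f k b : differentiable f b -> differentiable k b ->
  gradient (fun c => f c * k c) b = f b *: gradient k b + k b *: gradient f b.
Proof.
move=> df dk; apply/colP => i; rewrite !mxE.
by rewrite [LHS](deriveM (diff_derivable df) (diff_derivable dk)).
Qed.

Lemma eq_near_gradient f k b :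
  (\forall c \near b, f c = k c) -> gradient f b = gradient k b.
Proof. by move=> fk; apply/colP => i; rewrite !mxE; exact: near_eq_derive. Qed.

Lemma gradient_cst (a : R) b : gradient (fun=> a) b = 0.
Proof. by apply/colP => i; rewrite !mxE derive_cst. Qed.

Lemma gradientZ (a : R) f b : differentiable f b ->
  gradient (fun c => a * f c) b = a *: gradient f b.
Proof.
move=> df; apply/colP => i; rewrite !mxE.
exact: (@deriveZ _ _ _ _ a _ _ (diff_derivable df)).
Qed.

Lemma gradient_sum n (f : 'I_n -> 'cV[R]_p -> R) b :
  (forall i, differentiable (f i) b) ->
  gradient (fun c => \sum_(i < n) f i c) b = \sum_(i < n) gradient (f i) b.
Proof.
move=> df; apply/colP => i; rewrite summxE !mxE.
have -> : (fun c => \sum_(i < n) f i c) = \sum_(i < n) f i.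
  by apply/funext => c; rewrite fct_sumE.
rewrite derive_sum => [|j]; last exact: diff_derivable.
by apply: eq_bigr => j _; rewrite mxE.
Qed.

Lemma gradient_ln f b : differentiable f b -> 0 < f b ->
  gradient (fun c => ln (f c)) b = (f b)^-1 *: gradient f b.
Proof.
move=> df fb0; have [dln lnE] := is_derive1_ln fb0.
have dln' : differentiable (@ln R) (f b) by apply/derivable1_diffP.
apply/colP => i; rewrite !mxE.
rewrite deriveE; last exact: (differentiable_comp df dln').
have /(congr1 (fun F => F (delta_mx i 0))) /= dE := diff_comp df dln'.
rewrite [LHS]dE deriveE//.
rewrite (diff1E dln')/= derive1E lnE.
by rewrite mulrC.
Qed.

(** The derivative is the limit of the right-hand difference quotients, which are nonnegative close
    to a local minimum. *)
Lemma derive_ge0_at_min f b v : derivable f b v ->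
  (\forall c \near b, f b <= f c) -> 0 <= 'D_v f b.
Proof.
move=> df fmin.
rewrite /derive cvg_at_rightE//; apply: limr_ge.
  move: df => /cvg_ex[l dl]; apply/cvg_ex; exists l.
  move: dl; apply: cvg_trans; apply: cvg_app; apply: within_subset => h /=.
  by move=> /gt_eqF/negbT.
have v0 : h *: v + b @[h --> (0 : R)^'+] --> b.
  apply: cvg_at_right_filter.
  rewrite -[X in _ --> X]add0r -(scale0r v); apply: cvgD; last exact: cvg_cst.
  by apply: cvgZr_tmp; exact: cvg_id.
near=> h.
apply: mulr_ge0.
  rewrite invr_ge0; near: h; exact: nbhs_right_ge.
rewrite subr_ge0; near: h; exact: (v0 _ fmin).
Unshelve. all: by end_near. Qed.

(** Both directions [delta_mx i 0] and [- delta_mx i 0] have nonnegative derivatives, and these are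
    opposite by linearity of the differential. *)
Lemma gradient_at_min f b : differentiable f b ->
  (\forall c \near b, f b <= f c) -> gradient f b = 0.
Proof.
move=> df fmin; apply/colP => i; rewrite !mxE.
apply/eqP; rewrite eq_le; apply/andP; split; last first.
  by apply: derive_ge0_at_min => //; exact: diff_derivable.
have := derive_ge0_at_min (diff_derivable (v := - delta_mx i 0) df) fmin.
by rewrite !deriveE// linearN oppr_ge0.
Qed.

End Gradient.

(** * Square integrable functions and their inner products *)

Section L2.
Context (R : realType) (XX : set R) (G : probability (measurableTypeR R) R).
Hypothesis mXX : measurable XX.
Implicit Types f k : R -> R.

Lemma inL2_measurable f : inL2 XX G f -> measurable_fun XX f.
Proof.
rewrite /inL2 inE => /andP[/[!inE]/= mf _].
exact/(measurable_restrictT f mXX).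
Qed.

Lemma inL2_integrableM f k : inL2 XX G f -> inL2 XX G k ->
  G.-integrable XX (EFin \o (fun x => f x * k x)).
Proof.
move=> f2 k2; apply/(integrable_mkcond _ (mXX : measurable (XX : set (measurableTypeR R)))).
have /Lfun1_integrable := Lfun2_mul_Lfun1 f2 k2.
rewrite restrict_EFin; congr (_.-integrable _ _); apply/funext => x /=.
by rewrite !patchE; case: ifP => // _; rewrite mulr0.
Qed.

Lemma inL2_integrable f : inL2 XX G f -> G.-integrable XX (EFin \o f).
Proof.
move=> f2; apply/(integrable_mkcond _ (mXX : measurable (XX : set (measurableTypeR R)))).
rewrite restrict_EFin; apply/Lfun1_integrable.
by apply: Lfun_subset12 f2; exact: fin_num_measure.
Qed.

Lemma inL2D f k : inL2 XX G f -> inL2 XX G k ->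
  inL2 XX G (fun x => f x + k x).
Proof.
move=> f2 k2.
have -> : (fun x => f x + k x) = f \+ k by [].
rewrite /inL2; have -> : (f \+ k) \_ XX = (f \_ XX) \+ (k \_ XX).
  by apply/funext => x /=; rewrite !patchE; case: ifP => // _; rewrite addr0.
by apply: rpredD => //; rewrite lee1n.
Qed.

Lemma inL2Z f (a : R) : inL2 XX G f -> inL2 XX G (fun x => f x * a).
Proof.
move=> f2; rewrite /inL2.
have -> : (fun x => f x * a) \_ XX = a \o* (f \_ XX).
  by apply/funext => x /=; rewrite !patchE; case: ifP => // _; rewrite mul0r.
by apply: Lfun_scale => //; rewrite ler1n.
Qed.

Lemma inL2_sum (I : Type) (r : seq I) (F : I -> R -> R) :
  (forall i, inL2 XX G (F i)) -> inL2 XX G (fun x => \sum_(i <- r) F i x).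
Proof.
move=> F2; elim: r => [|i r ih].
  rewrite /inL2 (_ : _ \_ _ = cst 0) ?(Lfun_cst G 0 2)//.
  by apply/funext => x; rewrite patchE big_nil; case: ifP.
have -> : (fun x => \sum_(j <- i :: r) F j x) =
    (fun x => F i x + \sum_(j <- r) F j x).
  by apply/funext => x; rewrite big_cons.
exact: inL2D.
Qed.

Lemma inL2N f : inL2 XX G f -> inL2 XX G (fun x => - f x).
Proof.
move=> /(inL2Z (-1)); congr inL2.
by apply/funext => x; rewrite mulrN1.
Qed.

Lemma Rintegral_sum (I : Type) (r : seq I) (F : I -> R -> R) :
  (forall i, G.-integrable XX (EFin \o F i)) ->
  \int[G]_(x in XX) (\sum_(i <- r) F i x) =
  \sum_(i <- r) \int[G]_(x in XX) F i x.
Proof.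
move=> Fi; elim: r => [|i r ih].
  rewrite big_nil; under eq_Rintegral do rewrite big_nil.
  by rewrite Rintegral_cst// mul0r.
rewrite big_cons -ih -RintegralD//.
  by apply: eq_Rintegral => x _; rewrite big_cons.
have -> : EFin \o (fun x => \sum_(j <- r) F j x) =
    (fun x => \sum_(j <- r) (F j x)%:E)%E.
  by apply/funext => x /=; rewrite sumEFin.
by apply: integrable_sum => // j _; exact: Fi.
Qed.

Lemma innerC f k : inner XX G f k = inner XX G k f.
Proof. by rewrite /inner; under eq_Rintegral do rewrite mulrC. Qed.

Lemma inner_suml (I : Type) (r : seq I) (F : I -> R -> R) (a : I -> R) k :
  (forall i, inL2 XX G (F i)) -> inL2 XX G k ->
  inner XX G (fun x => \sum_(i <- r) F i x * a i) k =
  \sum_(i <- r) inner XX G (F i) k * a i.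
Proof.
move=> F2 k2.
transitivity (\int[G]_(x in XX) (\sum_(i <- r) (F i x * k x * a i))).
  by apply: eq_Rintegral => x _; rewrite mulr_suml; apply: eq_bigr => i _; rewrite mulrAC.
rewrite Rintegral_sum => [|i].
  by apply: eq_bigr => i _; rewrite RintegralZr//; exact: inL2_integrableM.
have := inL2_integrableM (inL2Z (a i) (F2 i)) k2.
by congr (_.-integrable _ _); apply/funext => x /=; rewrite mulrAC.
Qed.

Lemma innerBr f k l : inL2 XX G f -> inL2 XX G k -> inL2 XX G l ->
  inner XX G f (fun x => k x - l x) = inner XX G f k - inner XX G f l.
Proof.
move=> f2 k2 l2; rewrite -RintegralB//; try exact: inL2_integrableM.
by apply: eq_Rintegral => x _; rewrite mulrBr.
Qed.

Lemma inner_cv_mulmx (p : nat) (A : 'M[R]_p) (u : R -> 'cV[R]_p) k :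
  (forall i, inL2 XX G (fun x => u x i 0)) -> inL2 XX G k ->
  inner_cv XX G (fun x => A *m u x) k = A *m inner_cv XX G u k.
Proof.
move=> u2 k2; apply/colP => i; rewrite !mxE.
have -> : (fun x => (A *m u x) i 0) = (fun x => \sum_j u x j 0 * A i j).
  by apply/funext => x; rewrite mxE; apply: eq_bigr => j _; rewrite mulrC.
by rewrite inner_suml//; apply: eq_bigr => j _; rewrite mxE mulrC.
Qed.

End L2.

(** * Orthogonality of the projected functions to the score *)

Section Orthogonality.
Context (R : realType) (p : nat) (XX : set R).
Variables (G : 'cV[R]_p -> probability (measurableTypeR R) R)
  (g : 'cV[R]_p -> R -> R) (S : 'cV[R]_p -> 'M[R]_p)
  (h : 'cV[R]_p -> R -> R) (b : 'cV[R]_p).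
Hypotheses (mXX : measurable XX)
  (hu : forall i, inL XX (G b) (fun x => score g b x i 0))
  (hGamma : fisher XX G g b \in unitmx)
  (hS : principal_sqrt (invmx (fisher XX G g b)) (S b))
  (hh : inL XX (G b) (h b)).

Let u2 i : inL2 XX (G b) (fun x => score g b x i 0).
Proof. by have [] := hu i. Qed.

Let h2 : inL2 XX (G b) (h b). Proof. by have [] := hh. Qed.

(** Coefficients, with respect to the score components, of the orthogonal projection of [h b] onto
    their span. *)
Let a := invmx (fisher XX G g b) *m inner_cv XX (G b) (score g b) (h b).

(** The square root disappears: [S b] is symmetric and [S b *m S b] is the inverse Fisher matrix. *)
Lemma htildeE x :
  htilde XX G g S h b x = h b x - \sum_k score g b x k 0 * a k 0.
Proof.
have [ST _ SS] := hS.
rewrite /htilde /orthoscore inner_cv_mulmx// trmx_mul ST; congr (_ - _).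
rewrite -mulmxA (mulmxA (S b)) SS -/a mxE.
by apply: eq_bigr => k _; rewrite mxE.
Qed.

Lemma htilde_inL : inL XX (G b) (htilde XX G g S h b).
Proof.
have -> : htilde XX G g S h b =
    (fun x => h b x - \sum_k score g b x k 0 * a k 0).
  by apply/funext => x; rewrite htildeE.
have s2 : inL2 XX (G b) (fun x => \sum_k score g b x k 0 * a k 0).
  by apply: inL2_sum => k; exact: inL2Z.
split; first by apply: inL2D => //; exact: inL2N.
rewrite RintegralB//; try exact: inL2_integrable.
have [_ ->] := hh; rewrite sub0r Rintegral_sum//.
  rewrite big1 ?oppr0// => k _; rewrite RintegralZr//; last exact: inL2_integrable.
  by have [_ ->] := hu k; rewrite mul0r.
by move=> k; apply: inL2_integrable => //; exact: inL2Z.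
Qed.

(** The normal equations: the subtracted part has inner products $\Gamma\,\Gamma^{-1}\langle
    u,h\rangle=\langle u,h\rangle$ with the score. *)
Lemma inner_score_htilde :
  inner_cv XX (G b) (score g b) (htilde XX G g S h b) = 0.
Proof.
have s2 : inL2 XX (G b) (fun x => \sum_k score g b x k 0 * a k 0).
  by apply: inL2_sum => k; exact: inL2Z.
apply/colP => i; rewrite !mxE.
have -> : htilde XX G g S h b =
    (fun x => h b x - \sum_k score g b x k 0 * a k 0).
  by apply/funext => x; rewrite htildeE.
rewrite innerBr// [X in _ - X]innerC inner_suml//.
have -> : \sum_k inner XX (G b) (fun x => score g b x k 0)
    (fun x => score g b x i 0) * a k 0 = (fisher XX G g b *m a) i 0.
  by rewrite mxE; apply: eq_bigr => k _; rewrite [X in _ = X * _]mxE innerC.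
by rewrite /a mulmxA mulmxV// mul1mx mxE subrr.
Qed.

Lemma PiOp_orthogonal (psi : 'cV[R]_p -> R -> 'cV[R]_p)
    (f : 'cV[R]_p -> R -> R) :
  inner_cv XX (G b) (score g b) (f b) = 0 -> PiOp XX G g psi f b = f b.
Proof.
by move=> f0; apply/funext => x; rewrite /PiOp f0 mulmx0 mxE subr0.
Qed.

End Orthogonality.

(** * Expected gradients through differentiation under the integral sign *)

Section DensityGradient.
Context (R : realType) (p : nat) (XX : set R) (B : set 'cV[R]_p).
Variables (G : 'cV[R]_p -> probability (measurableTypeR R) R)
  (g : 'cV[R]_p -> R -> R) (b0 : 'cV[R]_p).
Hypotheses (mXX : measurable XX) (B_nbhs : nbhs b0 B)
  (hG : forall b, B b -> has_density XX (G b) (g b))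
  (hg : forall x, XX x -> differentiable (fun b => g b x) b0).

Let hb0 : B b0. Proof. exact: nbhs_singleton. Qed.

(* Where the density vanishes, it is minimal as a function of the parameter, so
   that the convention [score = 0] is consistent with [grad g = g * score]. *)
Lemma gradient_density x : XX x ->
  gradient (fun b => g b x) b0 = g b0 x *: score g b0 x.
Proof.
move=> Xx; rewrite /score; case: ifPn => [gx0|].
  by rewrite gradient_ln//; [rewrite scalerA divff ?scale1r// gt_eqF|exact: hg].
rewrite scaler0 => gx0; apply: gradient_at_min; first exact: hg.
have {}gx0 : g b0 x = 0.
  have [_ g0 _] := hG hb0.
  by apply/eqP; rewrite eq_le g0// andbT leNgt.
rewrite gx0; apply: filterS B_nbhs => b Bb.
by have [_ g0 _] := hG Bb; exact: g0.
Qed.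

Variables (N : set 'cV[R]_p) (f : 'cV[R]_p -> R -> R).
Hypotheses (hN : N b0)
  (hu : forall i, inL XX (G b0) (fun x => score g b0 x i 0))
  (hf : forall b, B b -> inL XX (G b) (f b))
  (hfd : forall x, XX x -> differentiable (fun b => f b x) b0)
  (hdiff : diff_under_int XX g N f).

(* A Borel version of the partial derivative; the derivative itself need not be
   measurable on the null set where the density vanishes. *)
Lemma expectation_gradient (i : 'I_p) : exists D : R -> R,
  [/\ (G b0).-integrable [set: R] (EFin \o D),
    fine (\int[G b0]_x (D x)%:E)%E
      = - inner XX (G b0) (fun x => score g b0 x i 0) (f b0) &
    {ae G b0, forall x, XX x /\ D x = gradient (fun b => f b x) b0 i 0}].
Proof.
have Gb0 := hG hb0; have [mg g0 _] := Gb0.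
have [u2 _] := hu i; have [f2 _] := hf hb0.
have [_ dFi dFE] := hdiff hN i.
set dF := (fun x => gradient (fun b => f b x * g b x) b0 i 0) in dFi dFE *.
pose u x := score g b0 x i 0.
(* This solves $\nabla(fg)=ufg+g\nabla f$ for $\nabla f$; the power with exponent [-1] is a
   reciprocal known to be measurable. *)
pose D0 x := dF x * g b0 x `^ (-1) - u x * f b0 x.
have dF_val x : XX x ->
    dF x = u x * f b0 x * g b0 x + gradient (fun b => f b x) b0 i 0 * g b0 x.
  move=> Xx; rewrite /dF gradientM; [|exact: hfd|exact: hg].
  by rewrite gradient_density// !mxE /u; ring.
have int0 b : B b -> \int[lebesgue_measure]_(x in XX) (f b x * g b x) = 0.
  move=> Bb; have [fb2 fb0] := hf Bb.
  by rewrite (density_integral mXX (hG Bb))//; exact: inL2_integrable.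
(* The integral of [f b * g b] is zero for every [b] in the neighbourhood [B] of [b0], so its
   gradient at [b0] is zero. *)
have dF0 : \int[lebesgue_measure]_(x in XX) dF x = 0.
  rewrite -dFE (@eq_near_gradient _ _ _ (fun=> 0)) ?gradient_cst ?mxE//.
  exact: filterS B_nbhs.
have D0_val x : XX x -> g b0 x != 0 -> D0 x = gradient (fun b => f b x) b0 i 0.
  move=> Xx gx0; rewrite /D0 dF_val// powR_inv1 ?g0//.
  by field.
(* The identity survives where the density vanishes, because [dF] vanishes there too. *)
have D0g x : XX x -> D0 x * g b0 x = dF x - u x * f b0 x * g b0 x.
  move=> Xx; have [gx0|gx0] := eqVneq (g b0 x) 0.
    by rewrite dF_val// gx0 !mulr0 addr0 subrr.
  by rewrite D0_val// dF_val//; ring.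
have ufi : (G b0).-integrable XX (EFin \o (fun x => u x * f b0 x)).
  exact: inL2_integrableM.
have muf : measurable_fun XX (fun x => u x * f b0 x).
  apply: measurable_funM; first exact: (inL2_measurable mXX u2).
  exact: (inL2_measurable mXX f2).
have ufgi := (density_integrable mXX Gb0 muf).1 ufi.
have mD0 : measurable_fun XX D0.
  apply: measurable_funB => //; apply: measurable_funM.
    by apply/measurable_EFinP; exact: measurable_int dFi.
  exact: measurableT_comp (measurable_powR _) mg.
have D0i : (G b0).-integrable XX (EFin \o D0).
  apply/(density_integrable mXX Gb0 mD0).
  apply: (eq_integrable (mXX : measurable (XX : set (measurableTypeR R))))
    (integrableB (mXX : measurable (XX : set (measurableTypeR R))) dFi ufgi).
  by move=> x /set_mem Xx; rewrite /= D0g.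
have D0E : \int[G b0]_(x in XX) D0 x = - inner XX (G b0) u (f b0).
  rewrite -(density_integral mXX Gb0)//.
  under eq_Rintegral => x /set_mem Xx do rewrite D0g//.
  rewrite RintegralB//.
  by rewrite dF0 sub0r (density_integral mXX Gb0).
exists (D0 \_ XX); split.
- rewrite -restrict_EFin.
  exact/(integrable_mkcond _ (mXX : measurable (XX : set (measurableTypeR R)))).
- by rewrite -D0E Rintegral_mkcond.
(* The exceptional set consists of the complement of [XX] and the zeros of the density, both null
   for [G b0]. *)
- exists (~` XX `|` (XX `&` [set x | g b0 x = 0])); split.
  + apply: measurableU; first exact: measurableC.
    by rewrite -[[set x | _]]/(g b0 @^-1` [set 0]); exact: mg.
  + apply: null_set_setU.
    * exact: measurableC.
    * by rewrite -[[set x | _]]/(g b0 @^-1` [set 0]); exact: mg.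
    * exact: density_setC0 mXX Gb0.
    * exact: density_eq0_null mXX Gb0.
  + move=> x /= nx; have [Xx|] := pselect (XX x); last by left.
    right; split => //; apply: contrapT => /eqP gx0; apply: nx; split => //.
    by rewrite patchE mem_set// D0_val.
Qed.

End DensityGradient.

(** * A matrix norm and a perturbation bound *)

Section EntrywiseNorm.
Context (R : realType).

(** This norm is submultiplicative for all shapes, and as a finite sum over entries it inherits
    [oP1] and [tight] from them. *)
Definition mx_norm1 m n (A : 'M[R]_(m, n)) : R := \sum_i \sum_j `|A i j|.

Lemma mx_norm1_ge0 m n (A : 'M[R]_(m, n)) : 0 <= mx_norm1 A.
Proof. by apply: sumr_ge0 => i _; exact: sumr_ge0. Qed.

Lemma mx_norm1D m n (A B : 'M[R]_(m, n)) :
  mx_norm1 (A + B) <= mx_norm1 A + mx_norm1 B.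
Proof.
rewrite /mx_norm1 -big_split; apply: ler_sum => i _ /=.
by rewrite -big_split; apply: ler_sum => j _; rewrite mxE; exact: ler_normD.
Qed.

Lemma mx_norm1N m n (A : 'M[R]_(m, n)) : mx_norm1 (- A) = mx_norm1 A.
Proof.
by apply: eq_bigr => i _; apply: eq_bigr => j _; rewrite mxE normrN.
Qed.

Lemma mx_norm1M m n k (A : 'M[R]_(m, n)) (B : 'M[R]_(n, k)) :
  mx_norm1 (A *m B) <= mx_norm1 A * mx_norm1 B.
Proof.
rewrite /mx_norm1 mulr_suml; apply: ler_sum => i _.
apply: (@le_trans _ _ (\sum_j \sum_l `|A i l| * `|B l j|)).
  apply: ler_sum => j _; rewrite mxE (le_trans (ler_norm_sum _ _ _))//.
  by apply: ler_sum => l _; rewrite normrM.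
(* For each [l], the absolute sum of row [l] of [B] is one of the nonnegative terms of
   [mx_norm1 B]. *)
rewrite exchange_big mulr_suml; apply: ler_sum => l _.
rewrite -mulr_sumr ler_wpM2l//.
by rewrite [leRHS](bigD1 l)//= lerDl; apply: sumr_ge0 => *; exact: sumr_ge0.
Qed.

(** Writing $s^T=s^TAM^{-1}-s^T(A-M)M^{-1}$, the last term has at most half the norm of $s^T$ and is
    absorbed on the left. Thus [s] is bounded through [s^T *m A] without inverting [A]. *)
Lemma norm_mulmx_perturb p (M A : 'M[R]_p) (s a : 'cV[R]_p) :
  M \in unitmx -> mx_norm1 (A - M) * mx_norm1 (invmx M) <= 2^-1 ->
  `|(s^T *m a) 0 0| <=
    2 * mx_norm1 (invmx M) * (mx_norm1 (s^T *m A) * mx_norm1 a).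
Proof.
move=> uM AM; set C := mx_norm1 (invmx M).
have sE : s^T = s^T *m A *m invmx M - s^T *m ((A - M) *m invmx M).
  by rewrite mulmxBl mulmxV// mulmxBr mulmx1 mulmxA opprB addrC subrK.
have s2 : mx_norm1 s^T <= 2 * (mx_norm1 (s^T *m A) * C).
  have : mx_norm1 s^T <= mx_norm1 (s^T *m A) * C + mx_norm1 s^T * 2^-1.
    rewrite {1}sE (le_trans (mx_norm1D _ _))// mx_norm1N lerD ?mx_norm1M//.
    rewrite (le_trans (mx_norm1M _ _))// ler_wpM2l ?mx_norm1_ge0//.
    exact: le_trans (mx_norm1M _ _) _.
  lra.
have -> : `|(s^T *m a) 0 0| = mx_norm1 (s^T *m a).
  by rewrite /mx_norm1 !big_ord1.
apply: le_trans (mx_norm1M _ _) _.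
apply: le_trans (ler_wpM2r (mx_norm1_ge0 _) s2) _.
by rewrite le_eqVlt; apply/orP; left; apply/eqP; ring.
Qed.

End EntrywiseNorm.

(** * Linear systems with a random matrix that converges in probability *)

Section StochasticLinearSystem.
Context d (Omega : measurableType d) (R : realType) (P : probability Omega R).

Lemma tight_cst (c : R) : tight P (fun _ _ => c).
Proof.
move=> e e0; exists (`|c| + 1); first by rewrite ltr_wpDl.
apply: nearW => n; rewrite (_ : [set _ | _] = set0) ?mu_ext0 ?lee_fin ?ltW//.
by apply/seteqP; split => // w /=; rewrite ltNge lerDl ler01.
Qed.

Lemma oP1_mx_norm1 m n (A : nat -> Omega -> 'M[R]_(m, n)) :
  (forall i j, oP1 P (fun k w => A k w i j)) ->
  oP1 P (fun k w => mx_norm1 (A k w)).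
Proof.
move=> A0; apply: oP1_sum => i; apply: oP1_sum => j.
by apply: le_oP1 (A0 i j); apply: nearW => k; apply: aeW => w; rewrite normr_id.
Qed.

Lemma tight_mx_norm1 m n (A : nat -> Omega -> 'M[R]_(m, n)) :
  (forall i j, tight P (fun k w => A k w i j)) ->
  tight P (fun k w => mx_norm1 (A k w)).
Proof.
move=> A0; apply: tight_sum => i; apply: tight_sum => j.
by apply: le_tight (A0 i j); apply: nearW => k; apply: aeW => w; rewrite normr_id.
Qed.

(** Outside an event of vanishing outer probability [A] is close enough to [M] for
    [norm_mulmx_perturb], whose bound is a tight factor times one that is $o_P(1)$. *)
Lemma oP1_mulmx_perturb p (M : 'M[R]_p) (A : nat -> Omega -> 'M[R]_p)
    (s a : nat -> Omega -> 'cV[R]_p) : M \in unitmx ->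
  (forall i k, oP1 P (fun n w => A n w i k - M i k)) ->
  (forall k, tight P (fun n w => ((s n w)^T *m A n w) 0 k)) ->
  (forall i, oP1 P (fun n w => a n w i 0)) ->
  oP1 P (fun n w => ((s n w)^T *m a n w) 0 0).
Proof.
move=> uM AM sA a0 e e0; set C := mx_norm1 (invmx M).
have AM0 : oP1 P (fun n w => C * mx_norm1 (A n w - M)).
  apply: tightM_oP1; first exact: tight_cst.
  apply: oP1_mx_norm1 => i k; apply: le_oP1 (AM i k).
  by apply: nearW => n; apply: aeW => w; rewrite !mxE.
have ra0 : oP1 P (fun n w => 2 * C *
    (mx_norm1 ((s n w)^T *m A n w) * mx_norm1 (a n w))).
  apply: tightM_oP1; first exact: tight_cst.
  apply: tightM_oP1.
    by apply: tight_mx_norm1 => i k; rewrite ord1; exact: sA.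
  by apply: oP1_mx_norm1 => i k; rewrite ord1; exact: a0.
have half0 : (0 : R) < 2^-1 by rewrite invr_gt0.
apply: (sub_vanishing _ (vanishingU (AM0 _ half0) (ra0 _ e0))).
apply: nearW => n w /= esa.
have [AMw|] := leP `|C * mx_norm1 (A n w - M)| 2^-1; last by left.
right; rewrite (lt_le_trans esa)//.
apply: le_trans (ler_norm _); apply: norm_mulmx_perturb => //.
by rewrite mulrC (le_trans (ler_norm _)).
Qed.

End StochasticLinearSystem.

(** * The empirical process at the true parameter and its gradient *)

Section EmpiricalProcess.
Context (R : realType) (p : nat) (XX : set R) (B N : set 'cV[R]_p).
Context d (Omega : measurableType d) (P : probability Omega R).
Variables (G : 'cV[R]_p -> probability (measurableTypeR R) R)
  (g : 'cV[R]_p -> R -> R) (b0 : 'cV[R]_p) (X : nat -> {RV P >-> R}).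
Hypotheses (mXX : measurable XX) (B_nbhs : nbhs b0 B) (hN : N b0)
  (hG : forall b, B b -> has_density XX (G b) (g b))
  (hg : forall x, XX x -> differentiable (fun b => g b x) b0)
  (hu : forall i, inL XX (G b0) (fun x => score g b0 x i 0))
  (hX : iid X (G b0)).
Let T := measurableTypeR R.

Lemma iid_pairwise_iid : pairwise_iid P (X : nat -> Omega -> T) (G b0).
Proof.
have [indX distX] := hX; split.
- by move=> i; exact: (@measurable_funPT _ _ _ _ (X i)).
- exact: distX.
move=> i j A C ij mA mC.
(* Independence is stated for a family of sets over all indices; on the list [[:: i; j]] only the
   values [A] at [i] and [C] at [j] matter. *)
pose E k := if k == i then A else C.
have mE k : measurable (E k) by rewrite /E; case: ifP.
have uij : uniq [:: i; j] by rewrite /= inE ij.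
have := indX [:: i; j] E uij mE.
have Ei : E i = A by rewrite /E eqxx.
have Ej : E j = C by rewrite /E eq_sym (negbTE ij).
rewrite !big_cons big_nil mule1 Ei Ej.
rewrite -[P (X i @^-1` A)]/(distribution P (X i) A) distX//.
rewrite -[P (X j @^-1` C)]/(distribution P (X j) C) distX// => <-.
congr (P _); apply/seteqP; split => [w [wA wB] k /=|w h].
  by rewrite !inE => /orP[]/eqP->; rewrite ?Ei ?Ej.
split.
  by have /= := h i; rewrite !inE eqxx Ei; exact.
by have /= := h j; rewrite !inE eqxx orbT Ej; exact.
Qed.

(** A countable union of null sets gives one null set that serves all observations at once. *)
Lemma iid_ae (Q : R -> Prop) : {ae G b0, forall x, Q x} ->
  {ae P, forall w, forall i, Q (X i w)}.
Proof.
move=> [E [mE E0 QE]]; have [_ distX] := hX.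
apply/ae_foralln => i; exists (X i @^-1` E); split.
- by rewrite -[_ @^-1` _]setTI; exact: measurable_funPT.
- by rewrite -[LHS]/(distribution P (X i) E) distX.
- by move=> w /= nQ; exact: QE.
Qed.

Variable f : 'cV[R]_p -> R -> R.
Hypotheses (hf : forall b, B b -> inL XX (G b) (f b))
  (hfd : forall x, XX x -> differentiable (fun b => f b x) b0)
  (hdiff : diff_under_int XX g N f).

Let hb0 : B b0. Proof. exact: nbhs_singleton. Qed.

Lemma empproc_centered b n w : B b ->
  empproc XX G X b n (f b) w =
  (Num.sqrt n%:R)^-1 * \sum_(i < n) f b (X i w).
Proof.
move=> Bb; congr (_ * _); apply: eq_bigr => i _.
by have [_ ->] := hf Bb; rewrite subr0.
Qed.

(** The centring integral depends on the parameter, but it is zero throughout a neighbourhood of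
    [b0], so only the sum is differentiated. *)
Lemma gradient_empproc n w : (forall i, XX (X i w)) ->
  gradient (fun b => empproc XX G X b n (f b) w) b0 =
  (Num.sqrt n%:R)^-1 *: \sum_(i < n) gradient (fun b => f b (X i w)) b0.
Proof.
move=> Xw.
rewrite (@eq_near_gradient _ _ _
  (fun b => (Num.sqrt n%:R)^-1 * \sum_(i < n) f b (X i w))); last first.
  by apply: filterS B_nbhs => b Bb; exact: empproc_centered.
have df (i : 'I_n) : differentiable (fun b => f b (X i w)) b0 by exact: hfd.
rewrite gradientZ ?gradient_sum//.
have -> : (fun b => \sum_(i < n) f b (X i w)) =
    \sum_(i < n) (fun b => f b (X i w)).
  by apply/funext => b; rewrite fct_sumE.
exact: differentiable_sum.
Qed.

(** The two factors $n^{-1/2}$ combine to $n^{-1}$, and the weak law applies to the Borel version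
    [D] of the partial derivative. *)
Lemma gradient_empproc_cvg (i : 'I_p) :
  oP1 P (fun n w => (Num.sqrt n%:R)^-1
    * gradient (fun b => empproc XX G X b n (f b) w) b0 i 0
    + inner XX (G b0) (fun x => score g b0 x i 0) (f b0)).
Proof.
have [D [Di DE Dgrad]] := expectation_gradient mXX B_nbhs hG hg hN hu hf hfd hdiff i.
apply: le_oP1 (weak_law iid_pairwise_iid Di).
apply: nearW => n; move: (iid_ae Dgrad); apply: filterS => w Dw.
rewrite gradient_empproc; last by move=> k; have [] := Dw k.
rewrite DE opprK !mxE summxE mulrA -invfM -expr2 sqr_sqrtr//.
rewrite [X in _ * X + _](eq_bigr (fun k : 'I_n => D (X k w)))// => k _.
by have [_ ->] := Dw k.
Qed.

Lemma empproc_tight : tight P (fun n w => empproc XX G X b0 n (f b0) w).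
Proof.
have [f2 f0] := hf hb0.
(* The tightness lemma needs a function on the whole line, so [f b0] is extended by zero; almost
   surely no observation leaves [XX]. *)
have f0' : (\int[G b0]_x ((f b0 \_ XX) x)%:E = 0)%E.
  move: f0; rewrite Rintegral_mkcond => f0.
  rewrite -[LHS]fineK ?[fine _]f0//.
  apply: integrable_fin_num => //; apply/Lfun1_integrable.
  by apply: Lfun_subset12 f2; exact: fin_num_measure.
apply: le_tight (iid_tight_sum iid_pairwise_iid f2 f0').
have aeXX : {ae G b0, forall x, XX x}.
  exists (~` XX); split => //.
  - exact: measurableC.
  - exact: density_setC0 mXX (hG hb0).
apply: nearW => n; move: (iid_ae aeXX); apply: filterS => w Xw.
rewrite empproc_centered// !normrM ler_wpM2l//.
rewrite [in leRHS](eq_bigr (fun i : 'I_n => f b0 (X i w)))// => i _.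
by rewrite patchE mem_set//; exact: Xw.
Qed.

End EmpiricalProcess.

(** * From the two Taylor expansions to the asymptotic equivalence *)

Theorem proposition2 (R : realType) (p : nat)
  (d : measure_display) (Omega : measurableType d) (P : probability Omega R)
  (XX : set R) (B N : set 'cV[R]_p) (b0 : 'cV[R]_p)
  (G : 'cV[R]_p -> probability (measurableTypeR R) R)
  (g : 'cV[R]_p -> R -> R)
  (S : 'cV[R]_p -> 'M[R]_p)
  (h : nat -> 'cV[R]_p -> R -> R)
  (psi : 'cV[R]_p -> R -> 'cV[R]_p)
  (M : nat -> nat)
  (X : nat -> {RV P >-> R})
  (bhat : nat -> Omega -> 'cV[R]_p)
  (* the parametric family *)
  (hp : (0 < p)%N)
  (hXX : measurable XX)
  (hb0 : B b0)
  (hN : exists2 U : set 'cV[R]_p, nbhs b0 U & N = closure U)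
  (hNB : N `<=` B)
  (hG : forall b, B b -> has_density XX (G b) (g b))
  (hg : forall b x, B b -> XX x -> differentiable (fun b' => g b' x) b)
  (* score and Fisher information *)
  (hu : forall b, B b -> forall i, inL XX (G b) (fun x => score g b x i 0))
  (hGamma : forall b, B b -> fisher XX G g b \in unitmx)
  (hS : forall b, B b -> principal_sqrt (invmx (fisher XX G g b)) (S b))
  (* the functions h_j, j >= 1 *)
  (hhL : forall b, B b -> forall j, (0 < j)%N -> inL XX (G b) (h j b))
  (hhon : forall b, B b -> forall j k, (0 < j)%N -> (0 < k)%N ->
     inner XX (G b) (h j b) (h k b) = (j == k)%:R)
  (hhC1 : forall j x, (0 < j)%N -> XX x ->
     C1_on N (fun b => htilde XX G g S (h j) b x))
  (* the estimating functions psi *)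
  (hpsiL : forall b, B b -> forall i, inL XX (G b) (fun x => psi b x i 0))
  (hpsifree : forall b, B b -> lin_indep XX (G b) (psi b))
  (hpsiunit : forall b, B b ->
     inner_mx XX (G b) (score g b) (psi b) \in unitmx)
  (hpsiC1 : forall i x, XX x -> C1_on N (fun b => psi b x i 0))
  (* the number of functions, fixed or growing to infinity *)
  (hMpos : forall n, (0 < M n)%N)
  (hM : (exists m, forall n, M n = m) \/ (M n @[n --> \oo] --> \oo))
  (* the sample and the estimator *)
  (hX : iid X (G b0))
  (hbhatB : forall n w, B (bhat n w))
  (hbhatmeas : forall n i, measurable_fun [set: Omega] (fun w => bhat n w i 0))
  (hbhatcons : oP1 P (fun n w => bhat n w - b0))
  (hbhatroot : forall n, {ae P, forall w, forall i,
     empproc XX G X (bhat n w) n (fun x => psi (bhat n w) x i 0) w = 0})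
  (* conditions (1) and (2) for h~_j, with j in {1, ..., M_n} for large n *)
  (hTaylor_h : forall j, (0 < j)%N -> (\forall n \near \oo, (j <= M n)%N) ->
     taylor_valid XX G X b0 bhat (htilde XX G g S (h j)))
  (hDiff_h : forall j, (0 < j)%N -> (\forall n \near \oo, (j <= M n)%N) ->
     diff_under_int XX g N (htilde XX G g S (h j)))
  (* conditions (1) and (2) for the components of psi *)
  (hTaylor_psi : forall i : 'I_p,
     taylor_valid XX G X b0 bhat (fun b x => psi b x i 0))
  (hDiff_psi : forall i : 'I_p,
     diff_under_int XX g N (fun b x => psi b x i 0)) :
  forall j, (0 < j)%N -> (\forall n \near \oo, (j <= M n)%N) ->
    (forall n w,
       empproc XX G X b0 n (htilde XX G g S (h j) b0) w
       = empproc XX G X b0 n (PiOp XX G g psi (htilde XX G g S (h j)) b0) w) /\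
    oP1 P (fun n w =>
       empproc XX G X b0 n (PiOp XX G g psi (htilde XX G g S (h j)) b0) w
       - empproc XX G X (bhat n w) n (htilde XX G g S (h j) (bhat n w)) w).
Proof.
move=> j j0 jM.
have Nb0 : N b0 by have [U Ub ->] := hN; apply: subset_closure; exact: nbhs_singleton.
have B_nbhs : nbhs b0 B.
  have [U Ub NE] := hN; apply: filterS Ub => b Ub.
  by apply: hNB; rewrite NE; exact: subset_closure.
have hg0 x : XX x -> differentiable (fun b => g b x) b0 by exact: hg.
pose f := htilde XX G g S (h j).
have fL b : B b -> inL XX (G b) (f b).
  move=> Bb; apply: htilde_inL => //; [exact: hu|exact: hS|exact: hhL].
have uf0 : inner_cv XX (G b0) (score g b0) (f b0) = 0.
  apply: inner_score_htilde => //; [exact: hu|exact: hGamma|exact: hS|].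
  exact: hhL.
(* Since the projected function is fixed by [PiOp], the first claim is an exact equality. *)
rewrite (PiOp_orthogonal psi uf0) -/f; split=> //.
have fd x : XX x -> differentiable (fun b => f b x) b0.
  by move=> Xx; have [+ _] := hhC1 j x j0 Xx; exact.
have psid i x : XX x -> differentiable (fun b => psi b x i 0) b0.
  by move=> Xx; have [+ _] := hpsiC1 i x Xx; exact.
pose grad (k : 'cV[R]_p -> R -> R) n w :=
  gradient (fun b => empproc XX G X b n (k b) w) b0.
(* The factors $\sqrt n$ and $n^{-1/2}$ leave the linear Taylor terms unchanged, while [A] and [a]
   acquire limits in probability. *)
pose s n w := Num.sqrt n%:R *: (bhat n w - b0).
pose A n w : 'M[R]_p := \matrix_(i, k)
  ((Num.sqrt n%:R)^-1 * grad (fun b x => psi b x k 0) n w i 0).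
pose a n w := (Num.sqrt n%:R)^-1 *: grad f n w.
(* At [n = 0] the square root is zero and the factors do not cancel, whence the restriction. *)
have scale n w (v : 'cV[R]_p) : (0 < n)%N ->
    ((s n w)^T *m ((Num.sqrt n%:R)^-1 *: v)) 0 0 = ((bhat n w - b0)^T *m v) 0 0.
  move=> n0; rewrite /s (_ : _^T = Num.sqrt n%:R *: (bhat n w - b0)^T);
    last by apply/rowP => i; rewrite !mxE.
  rewrite -scalemxAl -scalemxAr scalerA divff ?scale1r//.
  by rewrite gt_eqF// sqrtr_gt0 ltr0n.
have sa0 : oP1 P (fun n w => ((s n w)^T *m a n w) 0 0).
  apply: (@oP1_mulmx_perturb _ _ _ _ _
    (- inner_mx XX (G b0) (score g b0) (psi b0)) A).
  - by rewrite -scaleN1r unitmxZ ?unitrN1//; exact: hpsiunit.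
  - move=> i k.
    have := gradient_empproc_cvg hXX B_nbhs Nb0 hG hg0 (hu b0 hb0) hX
      (fun b Bb => hpsiL b Bb k) (psid k) (hDiff_psi k) i.
    by apply: le_oP1; apply: nearW => n; apply: aeW => w; rewrite !mxE opprK.
  - move=> k.
    (* At a root the Taylor remainder is $-(v_n(\psi_k)+s^TA_k)$, where $A_k$ is column [k]; adding
       $v_n(\psi_k)$, which is tight, leaves $-s^TA_k$. *)
    have := empproc_tight hXX B_nbhs hG hX (fun b Bb => hpsiL b Bb k).
    move=> /tightD/(_ (oP1_tight (hTaylor_psi k))); apply: le_tight.
    near=> n; move: (hbhatroot n); apply: filterS => w root.
    have n0 : (0 < n)%N by near: n; exact: nbhs_infty_gt.
    have -> : ((s n w)^T *m A n w) 0 k = ((s n w)^T *m ((Num.sqrt n%:R)^-1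
        *: grad (fun b x => psi b x k 0) n w)) 0 0.
      by rewrite !mxE; apply: eq_bigr => i _; rewrite !mxE.
    rewrite scale// root sub0r opprD addrA subrr sub0r normrN.
    exact: lexx.
  - move=> i.
    have := gradient_empproc_cvg hXX B_nbhs Nb0 hG hg0 (hu b0 hb0) hX
      fL fd (hDiff_h j j0 jM) i.
    apply: le_oP1; apply: nearW => n; apply: aeW => w; rewrite !mxE.
    (* By orthogonality to the score, the limit of the normalized gradient is zero. *)
    have /colP/(_ i) := uf0; rewrite !mxE => ->.
    by rewrite addr0.
(* The Taylor remainder plus the linear term is exactly the difference of the two empirical
   processes, up to sign. *)
apply: le_oP1 (oP1D (hTaylor_h j j0 jM) sa0).
near=> n; apply: aeW => w.
have n0 : (0 < n)%N by near: n; exact: nbhs_infty_gt.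
rewrite scale// -/f opprD addrA subrK distrC.
exact: lexx.
Unshelve. all: by end_near. Qed.
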